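(* Let $K\subset F$ be a field extension and let $A$ and $B$ be $n$-dimensional $K$-subspaces of $F$ with $n>1$. If $A$ is matched to $B$, then $\langle AB\rangle\neq A$.
   Context: $\langle AB\rangle$ denotes the $K$-subspace of $F$ spanned by $AB=\{ab: a\in A, b\in B\}$. An ordered basis $\{a_1,\dots,a_n\}$ of $A$ is matched to an ordered basis $\{b_1,\dots,b_n\}$ of $B$ if $a_i^{-1}A\cap B\subseteq\langle b_1,\dots,\hat b_i,\dots,b_n\rangle$ (the $K$-span of $\{b_j:j\ne i\}$) for each $i$. $A$ is matched to $B$ if every basis of $A$ can be matched to some basis of $B$. *)

(* Defs.v *)
From mathcomp Require Import all_boot all_order all_algebra.
From mathcomp Require Import boolp classical_sets.

Set Implicit Arguments.
Unset Strict Implicit.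
Unset Printing Implicit Defensive.

Import GRing.Theory.
Local Open Scope classical_set_scope.
Local Open Scope ring_scope.

(* A field extension K c F is an embedding iota : K -> F, so that [F : K] may
   be infinite; the K-vector space structure on F is c . x = iota c * x. *)
Section FieldExtension.
Variables (K F : fieldType) (iota : {rmorphism K -> F}).
Implicit Types (A B S : set F) (n : nat).

Definition is_subspace A : Prop :=
  A 0 /\ forall (c : K) (x y : F), A x -> A y -> A (iota c * x + y).

Definition kspan S : set F :=
  [set x | exists (m : nat) (c : 'I_m -> K) (s : 'I_m -> F),
     (forall i, S (s i)) /\ x = \sum_(i < m) iota (c i) * s i].

Definition lin_indep n (a : 'I_n -> F) : Prop :=
  forall c : 'I_n -> K,
    \sum_(i < n) iota (c i) * a i = 0 -> forall i, c i = 0.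

Definition ordered_basis A n (a : 'I_n -> F) : Prop :=
  lin_indep a /\ kspan (range a) = A.

Definition subspace_of_dim n A : Prop :=
  is_subspace A /\ exists a : 'I_n -> F, ordered_basis A a.

Definition prod_span A B : set F := kspan [set a * b | a in A & b in B].

Definition basis_matched A B n (a b : 'I_n -> F) : Prop :=
  forall i : 'I_n,
    [set (a i)^-1 * x | x in A] `&` B `<=` kspan [set b j | j in [set j | j != i]].

(* n is the common dimension of A and B. *)
Definition matched n A B : Prop :=
  forall a : 'I_n -> F, ordered_basis A a ->
    exists b : 'I_n -> F, ordered_basis B b /\ basis_matched A B a b.

End FieldExtension.

(* Main.v *)
Require Import Defs.
From mathcomp Require Import all_boot all_order all_algebra.
From mathcomp Require Import boolp classical_sets.

(* If <AB> = A, then a_i B is contained in A, so a_i^-1 A contains B for every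
   basis (a_i) of A. A matched basis (b_i) of B would then satisfy
   b_i \in B \subseteq <b_j : j != i>, against its independence. *)

Import GRing.Theory.
Local Open Scope classical_set_scope.
Local Open Scope ring_scope.

Section LinearIndependence.
Variables (K F : fieldType) (iota : {rmorphism K -> F}).

Lemma subset_kspan (S : set F) : S `<=` kspan iota S.
Proof.
move=> x Sx; exists 1%N, (fun=> 1), (fun=> x); split=> //.
by rewrite big_ord1 rmorph1 mul1r.
Qed.

(** A combination in [kspan] may repeat vectors and [b] may fail to be injective, so an index in [P]
    is chosen for each term, and coefficients with the same index are added. An index outside [P]
    gets an empty sum. *)
Lemma kspan_image (I : finType) (P : set I) (b : I -> F) (x : F) :
  kspan iota [set b j | j in P] x ->
  exists2 d : I -> K, (forall j, ~ P j -> d j = 0) & x = \sum_j iota (d j) * b j.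
Proof.
move=> [m [c [s [bs ->]]]].
have /choice[f Pf] k : exists j, P j /\ b j = s k.
  by have [j Pj bj] := bs k; exists j.
exists (fun j => \sum_(k | f k == j) c k) => [j nPj|].
  rewrite big1 // => k /eqP fk; case: nPj; rewrite -fk.
  by have [] := Pf k.
rewrite (partition_big f xpredT) //=; apply: eq_bigr => j _.
rewrite rmorph_sum mulr_suml; apply: eq_bigr => k /eqP <-.
by have [_ ->] := Pf k.
Qed.

(** Moving [b i] to the other side of such an expression gives a vanishing combination with
    coefficient [0 - 1] at [i]. *)
Lemma lin_indep_notin_kspan n (b : 'I_n -> F) (i : 'I_n) :
  lin_indep iota b -> ~ kspan iota [set b j | j in [set j | j != i]] (b i).
Proof.
move=> freeb /kspan_image[d d0 bE].
have di0 : d i = 0 by apply: d0; rewrite /= eqxx.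
have : d i - (i == i)%:R = 0.
  apply: (freeb (fun j => d j - (j == i)%:R)).
  under eq_bigr do rewrite rmorphB rmorph_nat mulrBl.
  rewrite sumrB -bE (bigD1 i) //= eqxx mul1r big1 ?addr0 ?subrr // => j.
  by move=> /negbTE ->; rewrite mul0r.
by rewrite di0 eqxx sub0r => /eqP; rewrite oppr_eq0 oner_eq0.
Qed.

Lemma lin_indep_neq0 n (a : 'I_n -> F) (i : 'I_n) :
  lin_indep iota a -> a i != 0.
Proof.
move=> freea; apply/eqP => ai0; apply: (@lin_indep_notin_kspan _ a i freea).
(* The empty combination puts 0 in every span. *)
rewrite ai0; exists 0%N, (fun=> 0), (fun=> 0).
by split=> [[]//|]; rewrite big_ord0.
Qed.

End LinearIndependence.

Theorem theorem1p4 (K F : fieldType) (iota : {rmorphism K -> F}) (n : nat)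
    (A B : set F) (n_gt1 : (1 < n)%N)
    (dimA : subspace_of_dim iota n A) (dimB : subspace_of_dim iota n B)
    (matchAB : matched iota n A B) :
  prod_span iota A B <> A.
Proof.
move=> ABA; have [_ [a basisa]] := dimA.
have [b [[freeb spanb] matchab]] := matchAB a basisa.
have [freea spana] := basisa.
(* One index suffices for the contradiction: [ltnW n_gt1] reads as [0 < n], so [i] is index 0. *)
pose i := Ordinal (ltnW n_gt1).
have Aa : A (a i) by rewrite -spana; apply: subset_kspan; exists i.
have Bb : B (b i) by rewrite -spanb; apply: subset_kspan; exists i.
have Aab : A (a i * b i).
  by rewrite -ABA; apply: subset_kspan; exists (a i) => //; exists (b i).
apply: (lin_indep_notin_kspan K F iota n b i freeb); apply: (matchab i); split=> //.
(* [b i] is [(a i)^-1 * (a i * b i)], as the basis vector [a i] is nonzero. *)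
by exists (a i * b i) => //; rewrite mulKf // (lin_indep_neq0 K F iota).
Qed.
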